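(* There exists an absolute constant $K>0$ (independent of all parameters below) such that the following holds. Let $d\geq 2$, $r\geq 1$, $k\geq 1$, $0\leq s\leq d$ be integers, let $C>0$, and let $\varepsilon,\delta\in(0,1)$. Let $\mathcal{A}$ be the random subsampled Walsh--Hadamard measurement operator with $m$ measurements. If $$m\ \geq\ \frac{16k2^s}{\varepsilon^2}\left[\log\frac{2}{\delta}+2dr^2\log\left(\frac{16Kd\sqrt{r}\,k2^s}{\varepsilon}\right)\right],$$ then, with probability at least $1-\delta$, $$\left|\,\|\mathcal{A}(\mathcal{X})\|_2^2-\|\mathcal{X}\|_F^2\,\right|\leq \varepsilon\|\mathcal{X}\|_F^2\qquad\text{for every }\mathcal{X}\in\mathfrak{M}_{r,s,k}(C).$$
   Context: Let $N=2^d$. Tensors $\mathcal{X}\in\mathbb{R}^{2\times\cdots\times 2}$ have $d$ modes, each of size 2. Vectorization: $[\operatorname{vec}(\mathcal{X})]_j=\mathcal{X}(i_1,\ldots,i_d)$ with $j=1+\sum_{q=1}^d(i_q-1)2^{q-1}$, $i_q\in\{1,2\}$. The Frobenius norm is $\|\mathcal{X}\|_F=\|\operatorname{vec}(\mathcal{X})\|_2$. Measurement operator. Let $\mathbf{H}_2=\frac{1}{\sqrt2}\begin{bmatrix}1&1\\1&-1\end{bmatrix}$ and $\mathbf{H}=\mathbf{H}_2^{\otimes d}\in\mathbb{R}^{N\times N}$ (Kronecker power). Draw $\nu_1,\ldots,\nu_m$ independently and uniformly from $\{1,\ldots,N\}$ (with replacement), and let $\mathbf{S}\in\mathbb{R}^{m\times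 N}$ be the matrix with $[\mathbf{S}\mathbf{z}]_\ell=z_{\nu_\ell}$. Set $\mathbf{A}=\sqrt{N/m}\,\mathbf{S}\mathbf{H}$ and $\mathcal{A}(\mathcal{X})=\mathbf{A}\operatorname{vec}(\mathcal{X})\in\mathbb{R}^m$. TT rank. For $q=1,\ldots,d-1$, let $\mathbf{X}^{\langle q\rangle}$ be the $2^q\times 2^{d-q}$ matrix unfolding of $\mathcal{X}$ whose row index is $(i_1,\ldots,i_q)$ and column index is $(i_{q+1},\ldots,i_d)$. Then $\operatorname{rank}_{\mathrm{TT}}(\mathcal{X})=(\operatorname{rank}\mathbf{X}^{\langle 1\rangle},\ldots,\operatorname{rank}\mathbf{X}^{\langle d-1\rangle})$, and $\operatorname{rank}_{\mathrm{TT}}(\mathcal{X})\leq r$ for a scalar $r$ means every component is at most $r$. Low-order model. Write $[d]=\{1,\ldots,d\}$. For $S\subseteq[d]$, let $\mathcal{E}_S$ be the canonical basis tensor whose single nonzero entry, equal to 1, is at the index with $i_j=2$ for $j\in S$ and $i_j=1$ for $j\notin S$. Define $$\mathrm{LC}_k(s)=\left\{\sum_{t=1}^k\mathcal{X}_{S_t}\ :\ S_t\subseteq[d],\ |S_t|\leq s,\ \mathcal{X}_{S_t}\in\operatorname{span}\{\mathcal{E}_I:I\subseteq S_t\},\ t=1,\ldots,k\right\}.$$ Model class: $$\mathfrak{M}_{r,s,k}(C)=\left\{\mathcal{X}\in\mathbb{R}^{2\times\cdots\times2}:\ \operatorname{rank}_{\mathrm{TT}}(\mathcal{X})\leq r,\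 \mathcal{X}\in\mathrm{LC}_k(s),\ \|\mathcal{X}\|_F\leq C\right\}.$$ *)

(* Defs.v *)
From mathcomp Require Import all_boot all_order all_algebra.
From mathcomp Require Export mxtens.
From mathcomp Require Import all_classical all_reals all_analysis.

Set Implicit Arguments.
Unset Strict Implicit.
Unset Printing Implicit Defensive.

Import Order.TTheory GRing.Theory Num.Theory.

Local Open Scope classical_set_scope.
Local Open Scope ring_scope.

(* Indices are 0-based: i_q in {1, 2} is represented by i_q - 1 in 'I_2, and
   the modes 1, ..., d and positions 1, ..., 2^d by 'I_d and 'I_(2 ^ d). *)
Notation multi_index d := {ffun 'I_d -> 'I_2}.

(* R^o rather than R, so that the tensors form a vectType over R. *)
Notation tensor R d := {ffun multi_index d -> R^o}.

Definition digit (n q : nat) : 'I_2 := inord ((n %/ 2 ^ q) %% 2).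

Lemma digit_sum d (i : multi_index d) (q : 'I_d) :
  digit (\sum_(p < d) i p * 2 ^ p)%N q = i q.
Proof.
suff H (f : nat -> nat) n k : (forall p, f p < 2)%N -> (k < n)%N ->
    ((\sum_(p < n) f p * 2 ^ p) %/ 2 ^ k %% 2 = f k)%N.
  pose f (p : nat) := if insub p is Some p' then nat_of_ord (i p') else 0%N.
  have fE (p : 'I_d) : f p = i p by rewrite /f valK.
  have flt p : (f p < 2)%N by rewrite /f; case: insub.
  apply: ord_inj; rewrite /digit inordK ?ltn_pmod//=.
  rewrite -(fE q) -(H f d q flt (ltn_ord q)).
  by congr ((_ %/ _) %% _)%N; apply: eq_bigr => p _; rewrite fE.
elim: n f k => // n IHn f k flt kn.
rewrite big_ord_recl expn0 muln1.
have -> : (\sum_(p < n) f (lift ord0 p) * 2 ^ (lift ord0 p) =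
           (\sum_(p < n) f p.+1 * 2 ^ p) * 2)%N.
  rewrite big_distrl/=; apply: eq_bigr => p _.
  by rewrite /bump/= add1n expnSr mulnA.
case: k kn => [|k] kn; first by rewrite expn0 divn1 addnC modnMDl modn_small.
rewrite expnS divnMA divnDMl// (divn_small (flt 0%N)) add0n.
exact: (IHn (fun p => f p.+1)).
Qed.

Section Tensors.
Variables (R : realType) (d : nat).
Implicit Types X : tensor R d.

Definition vec X : 'cV[R]_(2 ^ d) :=
  \col_(j < 2 ^ d) X [ffun q : 'I_d => digit j q].

Lemma vecE X (i : multi_index d) (j : 'I_(2 ^ d)) :
  j = (\sum_(q < d) i q * 2 ^ q)%N :> nat -> vec X j 0 = X i.
Proof.
by move=> jE; rewrite mxE; congr (X _); apply/ffunP => q; rewrite ffunE jE digit_sum.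
Qed.

(* The norm provided by the library on matrices is the max norm. *)
Definition l2norm n (x : 'cV[R]_n) : R := Num.sqrt (\sum_(i < n) x i 0 ^+ 2).

Definition frob_norm X : R := l2norm (vec X).

(* Rows are indexed by the first q modes, columns by the d - q last ones. *)
Definition unfolding (q : nat) X : 'M[R]_(2 ^ q, 2 ^ (d - q)) :=
  \matrix_(a < 2 ^ q, b < 2 ^ (d - q))
    X [ffun p : 'I_d => if (p < q)%N then digit a p else digit b (p - q)].

Definition tt_rank X : seq nat :=
  [seq \rank (unfolding q X) | q <- iota 1 d.-1].

Definition basis_tensor (S : {set 'I_d}) : tensor R d :=
  [ffun i => (i == [ffun p => if p \in S then ord_max else ord0])%:R].

Definition low_order (k s : nat) : set (tensor R d) :=
  [set X | exists (S : 'I_k -> {set 'I_d}) (Y : 'I_k -> tensor R d),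
    [/\ forall t, (#|S t| <= s)%N,
        forall t, Y t \in <<[seq basis_tensor U | U : {set 'I_d} in powerset (S t)]>>%VS
      & X = \sum_(t < k) Y t]].

Definition model_class (r s k : nat) (C : R) : set (tensor R d) :=
  [set X | [/\ all (fun p => p <= r)%N (tt_rank X),
               low_order k s X & frob_norm X <= C]].

Definition hadamard2 : 'M[R]_2 :=
  (Num.sqrt 2)^-1 *: \matrix_(i < 2, j < 2)
    (if (i == ord_max) && (j == ord_max) then -1 else 1).

Definition walsh_hadamard : 'M[R]_(2 ^ d) := ntensmx hadamard2 d.

Definition sampling m (nu : 'I_m -> 'I_(2 ^ d)) : 'M[R]_(m, 2 ^ d) :=
  \matrix_(l < m, j < 2 ^ d) (j == nu l)%:R.

Lemma samplingE m (nu : 'I_m -> 'I_(2 ^ d)) (z : 'cV[R]_(2 ^ d)) l :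
  (sampling nu *m z) l 0 = z (nu l) 0.
Proof.
rewrite mxE (bigD1 (nu l))//= mxE eqxx mul1r big1 ?addr0// => j jl.
by rewrite mxE (negbTE jl) mul0r.
Qed.

Definition measurement_mx m (nu : 'I_m -> 'I_(2 ^ d)) : 'M[R]_(m, 2 ^ d) :=
  Num.sqrt ((2 ^ d)%:R / m%:R) *: (sampling nu *m walsh_hadamard).

Definition measurement m (nu : 'I_m -> 'I_(2 ^ d)) X : 'cV[R]_m :=
  measurement_mx nu *m vec X.

End Tensors.

(* 'I_n carries the discrete sigma-algebra: every B is measurable. *)
Definition iid_uniform (disp : measure_display) (T : measurableType disp)
    (R : realType) (P : probability T R) (m n : nat) (nu : 'I_m -> T -> 'I_n) :=
  [/\ forall l (B : set 'I_n), measurable (nu l @^-1` B),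
      forall l j, P (nu l @^-1` [set j]) = (n%:R^-1)%:E
    & forall (J : {set 'I_m}) (B : 'I_m -> set 'I_n),
        P (\bigcap_(l in [set` J]) (nu l @^-1` B l)) =
        (\prod_(l in J) P (nu l @^-1` B l))%E].

(* Main.v *)
(**
Every tensor of unit norm in the model has at most [b = k * 2 ^ s] nonzero
entries, and the rows of the orthogonal matrix [H] have entries of modulus
[2 ^ (- d / 2)], so its measurements [N (H x)_j ^ 2] lie in [[0, b]] and have
mean [1]; a Chernoff bound controls their average for one tensor. Differences
of two such tensors still have at most [2 b] nonzero entries, so the measured
energy is [4 b]-Lipschitz on the normalized model, and it suffices to treat an
[eps / (8 b)]-net contained in the model.

The net comes from left-orthogonal tensor-train decompositions: the
[n = 2 d r ^ 2] core entries form a vector of norm at most [sqrt (d r)], and the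
tensor depends on the cores in a Lipschitz way because all partial products are
contractions. Rounding the cores to a grid gives integer vectors of [l^1] norm
at most [n M] with [M = d sqrt r / eta], and there are at most
[(2 e (M + 1)) ^ n] of those; choosing a representative in each nonempty class
keeps the net inside the model, in particular sparse. No union over the
supports [S_1, ..., S_k] is needed.
*)

Require Import Defs.
From mathcomp Require Import all_boot all_order all_algebra.
From mathcomp Require Import all_classical all_reals all_analysis.
From mathcomp Require Import ring lra zify.

Set Implicit Arguments.
Unset Strict Implicit.
Unset Printing Implicit Defensive.

Import Order.TTheory GRing.Theory Num.Theory.

Local Open Scope classical_set_scope.
Local Open Scope ring_scope.

(** * Euclidean norms, partial isometries and orthonormal frames of column spaces *)

Section Euclidean.
Variable R : realType.

(** Lagrange's identity: the double sum of squares below is twice the difference of the two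
    sides. *)
Lemma cauchy_schwarz_sum (I : finType) (f g : I -> R) :
  (\sum_i f i * g i) ^+ 2 <= (\sum_i f i ^+ 2) * (\sum_i g i ^+ 2).
Proof.
have : 0 <= \sum_i \sum_j (f i * g j - f j * g i) ^+ 2.
  by apply: sumr_ge0 => i _; apply: sumr_ge0 => j _; exact: sqr_ge0.
rewrite (_ : \sum_i _ = 2 * ((\sum_i f i ^+ 2) * (\sum_i g i ^+ 2) -
   (\sum_i f i * g i) ^+ 2)); first by rewrite pmulr_rge0// subr_ge0.
pose s := \sum_i \sum_j (f i ^+ 2 * g j ^+ 2).
have sE : (\sum_i f i ^+ 2) * (\sum_i g i ^+ 2) = s.
  by rewrite mulr_suml; apply: eq_bigr => i _; rewrite mulr_sumr.
have sE' : \sum_i \sum_j (f j ^+ 2 * g i ^+ 2) = s by rewrite exchange_big.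
have -> : (\sum_i f i * g i) ^+ 2 = \sum_i \sum_j (f i * g i) * (f j * g j).
  by rewrite expr2 mulr_suml; apply: eq_bigr => i _; rewrite mulr_sumr.
rewrite sE mulrBr mulr_natl mulr2n -{1}sE' /s -!big_split/= mulr_sumr -sumrB.
apply: eq_bigr => i _; rewrite mulr_sumr -big_split -sumrB/=.
by apply: eq_bigr => j _; ring.
Qed.

Lemma l2norm_sqr n (x : 'cV[R]_n) : l2norm x ^+ 2 = \sum_i x i 0 ^+ 2.
Proof. by rewrite sqr_sqrtr// sumr_ge0// => i _; exact: sqr_ge0. Qed.

Lemma l2norm_ge0 n (x : 'cV[R]_n) : 0 <= l2norm x.
Proof. exact: sqrtr_ge0. Qed.

Lemma l2norm_dot n (x : 'cV[R]_n) : l2norm x ^+ 2 = (x^T *m x) 0 0.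
Proof. by rewrite l2norm_sqr mxE; apply: eq_bigr => i _; rewrite mxE expr2. Qed.

Lemma l2norm_eq0 n (x : 'cV[R]_n) : (l2norm x == 0) = (x == 0).
Proof.
apply/eqP/eqP => [x0|->].
  have /eqP : l2norm x ^+ 2 = 0 by rewrite x0 expr0n.
  rewrite l2norm_sqr psumr_eq0 => [/allP h|i _]; last exact: sqr_ge0.
  apply/colP => i; rewrite mxE; apply/eqP; rewrite -sqrf_eq0.
  exact: h (mem_index_enum i).
by apply/eqP; rewrite -sqrf_eq0 l2norm_sqr big1// => i _; rewrite mxE expr0n.
Qed.

Lemma l2norm_delta n (c : 'I_n) : l2norm (delta_mx c 0 : 'cV[R]_n) = 1.
Proof.
apply/eqP; rewrite -(@eqrXn2 _ 2) ?l2norm_ge0// expr1n l2norm_sqr.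
rewrite (bigD1 c)//= big1 ?addr0 => [|j /negbTE jc].
  by rewrite mxE !eqxx expr1n.
by rewrite mxE jc expr0n.
Qed.

Lemma l2normZ n a (x : 'cV[R]_n) : l2norm (a *: x) = `|a| * l2norm x.
Proof.
apply/eqP; rewrite -(@eqrXn2 _ 2) ?mulr_ge0 ?l2norm_ge0//.
rewrite exprMn real_normK ?num_real// !l2norm_sqr mulr_sumr.
by apply/eqP; apply: eq_bigr => i _; rewrite mxE exprMn.
Qed.

Lemma ler_l2normD n (x y : 'cV[R]_n) : l2norm (x + y) <= l2norm x + l2norm y.
Proof.
rewrite -(@ler_pXn2r _ 2) ?nnegrE ?addr_ge0 ?l2norm_ge0//.
have -> : l2norm (x + y) ^+ 2 =
    l2norm x ^+ 2 + l2norm y ^+ 2 + (\sum_i x i 0 * y i 0) *+ 2.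
  rewrite !l2norm_sqr -mulr_natl mulr_sumr -!big_split/=.
  by apply: eq_bigr => i _; rewrite mxE; ring.
suff : \sum_i x i 0 * y i 0 <= l2norm x * l2norm y by lra.
apply: le_trans (ler_norm _) _.
rewrite -(@ler_pXn2r _ 2) ?nnegrE ?mulr_ge0 ?l2norm_ge0//.
by rewrite real_normK ?num_real// exprMn !l2norm_sqr; exact: cauchy_schwarz_sum.
Qed.

Lemma l2norm_mulmx_le m n (A : 'M[R]_(m, n)) (x : 'cV[R]_n) :
  l2norm (A *m x) ^+ 2 <= (\sum_i \sum_j A i j ^+ 2) * l2norm x ^+ 2.
Proof.
rewrite !l2norm_sqr mulr_suml; apply: ler_sum => i _.
by rewrite mxE; exact: cauchy_schwarz_sum.
Qed.

(** Unlike [Q^T *m Q = 1%:M], this form allows zero columns, so a frame can be padded to a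
    prescribed width. It makes [Q *m Q^T] the orthogonal projection onto the column space of [Q]. *)
Definition partial_isometry m n (Q : 'M[R]_(m, n)) := Q *m Q^T *m Q = Q.

Lemma partial_isometry_tr m n (Q : 'M[R]_(m, n)) :
  partial_isometry Q -> partial_isometry Q^T.
Proof.
by move=> QQ; rewrite /partial_isometry -[in RHS]QQ !trmx_mul mulmxA.
Qed.

(** Pythagoras: the loss of squared norm is the squared norm of the residual
    [x - Q^T *m (Q *m x)]. *)
Lemma partial_isometry_le m n (Q : 'M[R]_(m, n)) (x : 'cV[R]_n) :
  partial_isometry Q -> l2norm (Q *m x) <= l2norm x.
Proof.
move=> QQ; rewrite -(@ler_pXn2r _ 2) ?nnegrE ?l2norm_ge0// -subr_ge0.
suff -> : l2norm x ^+ 2 - l2norm (Q *m x) ^+ 2 =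
    l2norm (x - Q^T *m (Q *m x)) ^+ 2 by exact: sqr_ge0.
rewrite !l2norm_dot !linearB/= !trmx_mul trmxK !mulmxBl.
have -> : x^T *m Q^T *m Q *m (Q^T *m (Q *m x)) = x^T *m Q^T *m (Q *m x).
  by rewrite -!mulmxA; congr (_ *m (_ *m _)); rewrite !mulmxA QQ.
rewrite !mulmxA; rewrite [in RHS]mxE.
by rewrite !mxE; lra.
Qed.

(** The frame is given by its coefficients [W], which keeps it inside the column space of [B]. The
    induction orthogonalizes the first column against a frame of the remaining ones. *)
Lemma gram_schmidt n r (B : 'M[R]_(n, r)) :
  exists W : 'M[R]_r, B *m W *m (B *m W)^T *m B = B.
Proof.
elim: r => [|r IHr] in B *.
  by exists 0; apply/matrixP => i [].
rewrite -[B](@hsubmxK _ n 1 r); move: (lsubmx _) (rsubmx _) => b B1.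
have [W1] := IHr B1; move Q1E : (B1 *m W1) => Q1 QB1.
have QQ1 : partial_isometry Q1.
  by rewrite /partial_isometry -[in X in _ *m X = _]Q1E mulmxA QB1.
(* If [b] lies in the span of [B1], then [b' = 0] and [c = 0^-1 = 0]: the frame receives a zero
   column. *)
pose b' := b - Q1 *m Q1^T *m b; pose c := (l2norm b')^-1.
have b'Q1 : b'^T *m Q1 = 0.
  rewrite /b' linearB/= !trmx_mul trmxK mulmxBl -!mulmxA.
  by rewrite [Q1 *m _]mulmxA QQ1 subrr.
have b'B1 : b'^T *m B1 = 0.
  by rewrite -QB1 !mulmxA b'Q1 !mul0mx.
pose W : 'M[R]_(1 + r) := block_mx c%:M 0 (- (c *: (W1 *m Q1^T *m b))) W1.
have QE : row_mx b B1 *m W = row_mx (c *: b') Q1.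
  rewrite /W mul_row_block mulmx0 add0r mul_mx_scalar mulmxN -scalemxAr !mulmxA.
  by rewrite Q1E -scalerBr.
suff H : row_mx b B1 *m W *m (row_mx b B1 *m W)^T *m row_mx b B1 = row_mx b B1.
  by exists W.
rewrite QE.
rewrite tr_row_mx mul_row_col mulmxDl !mul_mx_row QB1 add_row_mx.
have -> : c *: b' *m (c *: b')^T = c ^+ 2 *: (b' *m b'^T).
  by rewrite linearZ/= -scalemxAr -scalemxAl scalerA expr2.
rewrite -!scalemxAl -!mulmxA b'B1 mulmx0 scaler0 add0r; congr row_mx.
have -> : b' *m (b'^T *m b) = (l2norm b') ^+ 2 *: b'.
  rewrite (_ : b'^T *m b = b'^T *m b').
    by rewrite [b'^T *m b']mx11_scalar -l2norm_dot mul_mx_scalar.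
  by rewrite {3}/b' mulmxBr !mulmxA b'Q1 !mul0mx subr0.
have [b0|b0] := eqVneq (l2norm b') 0.
  rewrite b0 expr0n/= scale0r scaler0 add0r.
  by move/eqP: b0; rewrite l2norm_eq0 /b' subr_eq0 mulmxA => /eqP.
by rewrite scalerA -exprMn mulVf// expr1n scale1r /b' !mulmxA subrK.
Qed.

Lemma colspace_frame n p r (A : 'M[R]_(n, p)) : (\rank A <= r)%N ->
  exists W : 'M[R]_(p, r), A *m W *m (A *m W)^T *m A = A.
Proof.
move=> rA.
have colE : A *m pinvmx (row_base A) = col_base A.
  have := congr1 (mulmxr (pinvmx (row_base A))) (mulmx_base A).
  by rewrite /= mulmxKp ?row_base_free.
move: (pinvmx _) colE (row_base A) (mulmx_base A) => V <- C ACE.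
(* A basis of [\rank A] columns is padded with zeros to the common width [r]. *)
pose B : 'M[R]_(n, r) := A *m V *m pid_mx (\rank A).
have AB : A = B *m (pid_mx (\rank A) *m C).
  rewrite /B -!mulmxA [pid_mx _ *m (_ *m _)]mulmxA pid_mx_id//.
  by rewrite pid_mx_1 mul1mx mulmxA ACE.
have [W BW] := gram_schmidt B.
exists (V *m pid_mx (\rank A) *m W).
by rewrite !mulmxA -/B [X in _ *m X = _]AB mulmxA BW -AB.
Qed.

End Euclidean.

(** * Left-orthogonal tensor trains and their Lipschitz dependence on the cores *)

Section TensorTrain.
Variable R : realType.

Lemma snoc_subproof q (i : 'I_2) (a : 'I_(2 ^ q)) : (a + 2 ^ q * i < 2 ^ q.+1)%N.
Proof. by case: i => -[|[|]]//= _; have := ltn_ord a; rewrite expnS; lia. Qed.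

(* Appends the digit [i] to the binary expansion, least significant digit
   first, of [a]. *)
Definition snoc q (i : 'I_2) (a : 'I_(2 ^ q)) : 'I_(2 ^ q.+1) :=
  Ordinal (snoc_subproof i a).

Lemma snoc_lo_subproof q (a : 'I_(2 ^ q.+1)) : (a %% 2 ^ q < 2 ^ q)%N.
Proof. by rewrite ltn_mod expn_gt0. Qed.

Lemma snoc_hi_subproof q (a : 'I_(2 ^ q.+1)) : (a %/ 2 ^ q < 2)%N.
Proof. by rewrite ltn_divLR ?expn_gt0// -expnS. Qed.

Definition snoc_lo q (a : 'I_(2 ^ q.+1)) := Ordinal (snoc_lo_subproof a).
Definition snoc_hi q (a : 'I_(2 ^ q.+1)) := Ordinal (snoc_hi_subproof a).

Lemma snocK q (a : 'I_(2 ^ q.+1)) : snoc (snoc_hi a) (snoc_lo a) = a.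
Proof. by apply: val_inj; rewrite /= addnC mulnC -divn_eq. Qed.

Lemma snoc_loK q i (a : 'I_(2 ^ q)) : snoc_lo (snoc i a) = a.
Proof. by apply: val_inj; rewrite /= addnC mulnC modnMDl modn_small. Qed.

Lemma snoc_hiK q i (a : 'I_(2 ^ q)) : snoc_hi (snoc i a) = i.
Proof.
by apply: val_inj; rewrite /= addnC mulnC divnMDl ?expn_gt0// divn_small ?addn0.
Qed.

Definition row_half q n (i : 'I_2) (M : 'M[R]_(2 ^ q.+1, n)) : 'M[R]_(2 ^ q, n) :=
  rowsub (snoc i) M.

Definition stack_rows q n (F : 'I_2 -> 'M[R]_(2 ^ q, n)) : 'M[R]_(2 ^ q.+1, n) :=
  \matrix_(a, c) F (snoc_hi a) (snoc_lo a) c.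

Lemma row_half_stack q n (F : 'I_2 -> 'M[R]_(2 ^ q, n)) i :
  row_half i (stack_rows F) = F i.
Proof. by apply/matrixP => a c; rewrite !mxE snoc_loK snoc_hiK. Qed.

Lemma row_half_inj q n (M M' : 'M[R]_(2 ^ q.+1, n)) :
  (forall i, row_half i M = row_half i M') -> M = M'.
Proof.
move=> MM'; apply/matrixP => a c; rewrite -(snocK a).
by have /matrixP/(_ (snoc_lo a) c) := MM' (snoc_hi a); rewrite !mxE.
Qed.

Lemma row_half_mul q m n i (M : 'M[R]_(2 ^ q.+1, m)) (N : 'M[R]_(m, n)) :
  row_half i (M *m N) = row_half i M *m N.
Proof. by rewrite /row_half mul_rowsub_mx. Qed.

Lemma row_halfD q n i (M N : 'M[R]_(2 ^ q.+1, n)) :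
  row_half i (M + N) = row_half i M + row_half i N.
Proof. by apply/matrixP => a c; rewrite !mxE. Qed.

Lemma row_halfB q n i (M N : 'M[R]_(2 ^ q.+1, n)) :
  row_half i (M - N) = row_half i M - row_half i N.
Proof. by apply/matrixP => a c; rewrite !mxE. Qed.

Lemma l2norm_row_half q (x : 'cV[R]_(2 ^ q.+1)) :
  l2norm x ^+ 2 = \sum_i l2norm (row_half i x) ^+ 2.
Proof.
under eq_bigr do rewrite l2norm_sqr.
rewrite pair_bigA l2norm_sqr/= (reindex (fun p : 'I_2 * 'I_(2 ^ q) => snoc p.1 p.2)).
  by apply: eq_bigr => -[i a] _; rewrite !mxE.
exists (fun a => (snoc_hi a, snoc_lo a)) => [[i a] _|a _] /=.
  by rewrite snoc_hiK snoc_loK.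
exact: snocK.
Qed.

(** Reading entries at a natural number lets unfoldings at different [q], which have different
    types, be compared through one linear index. *)
Definition tensor_entry d (X : tensor R d) (j : nat) : R :=
  X [ffun p : 'I_d => digit j p].

Lemma unfoldingE d (X : tensor R d) q a b :
  unfolding q X a b = tensor_entry X (a + 2 ^ q * b).
Proof.
rewrite mxE; congr (X _); apply/ffunP => p; rewrite !ffunE.
have := ltn_ord a; move: (nat_of_ord a) (nat_of_ord b) => {}a {}b aq.
case: ltnP => pq; congr (inord _); last first.
  rewrite -[in RHS](subnKC pq) expnD divnMA.
  by rewrite addnC mulnC divnMDl ?expn_gt0// (divn_small aq) addn0.
rewrite -[in RHS](subnKC (ltnW pq)) expnD addnC -mulnA mulnC.
rewrite divnMDl ?expn_gt0//.
move: pq; rewrite -subn_gt0; case: (q - p)%N => // n _.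
by rewrite expnS mulnAC -mulnA mulnC modnMDl.
Qed.

(** Row [a + 2 ^ q * i] and column [b] at level [q.+1] have the same linear index as row [a] and
    column [i + 2 * b] at level [q]. Hence the column space of each half lies in that of the
    previous unfolding. *)
Lemma row_half_unfolding d (X : tensor R d) q i : (q < d)%N ->
  exists f, row_half i (unfolding q.+1 X) = colsub f (unfolding q X).
Proof.
move=> qd.
have flt (b : 'I_(2 ^ (d - q.+1))) : (i + 2 * b < 2 ^ (d - q))%N.
  move: (ltn_ord b) (ltn_ord i).
  have -> : (d - q = (d - q.+1).+1)%N by lia.
  by rewrite expnS; lia.
exists (fun b => Ordinal (flt b)); apply/matrixP => a b.
rewrite !(mxE, unfoldingE)/=; congr (X _); apply/ffunP => p; rewrite !ffunE.
by congr digit; rewrite expnS; lia.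
Qed.

(* [Q q] has as columns an orthonormal basis, padded with zeros, of the span of
   the left interfaces at mode [q], so that
   [X (i_1, ..., i_d) = core 0 i_1 *m ... *m core d.-1 i_d] is a left-orthogonal
   tensor-train decomposition. *)
Definition tt_frames d r (X : tensor R d) (Q : forall q, 'M[R]_(2 ^ q, r.+1)) :=
  [/\ Q 0%N = \matrix_(a, c) (c == 0)%:R,
      forall q, (q <= d)%N -> partial_isometry (Q q),
      forall q i, (q < d)%N ->
        Q q *m (Q q)^T *m row_half i (Q q.+1) = row_half i (Q q.+1)
    & Q d *m delta_mx 0 0 = vec X].

Definition core r (Q : forall q, 'M[R]_(2 ^ q, r.+1)) q i : 'M[R]_r.+1 :=
  (Q q)^T *m row_half i (Q q.+1).

(** The frames are chosen independently of one another, [Q q] from the column space of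
    [unfolding q X]; successive frames are compatible because row halves of an unfolding consist of
    columns of the previous one. At [q = d], the unit norm lets [vec X] itself serve as the only
    nonzero column. *)
Lemma tt_frames_exist d r (X : tensor R d) : (0 < d)%N -> frob_norm X = 1 ->
  all (fun p => p <= r.+1)%N (tt_rank X) -> exists Q, @tt_frames d r X Q.
Proof.
move=> d0 X1 /allP rX.
pose e : 'rV[R]_r.+1 := delta_mx 0 0.
have ee : e *m e^T = 1%:M.
  by rewrite /e trmx_delta mul_delta_mx; apply/matrixP => i j; rewrite !mxE !ord1.
have xx : (vec X)^T *m vec X = 1%:M.
  by rewrite [LHS]mx11_scalar -l2norm_dot -/(frob_norm X) X1 expr1n.
pose P q (M : 'M[R]_(2 ^ q, r.+1)) :=
  [/\ q = 0%N -> M = \matrix_(a, c) (c == 0)%:R,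
  partial_isometry M, M *m M^T *m unfolding q X = unfolding q X,
  (0 < q)%N -> exists W, M = unfolding q X *m W
  & q = d -> forall a : 'I_(2 ^ q), M a 0 = tensor_entry X a].
have PE q : (q <= d)%N -> exists M, P q M.
  case: q => [_|q]; last rewrite leq_eqVlt => /predU1P[qd|qd].
  - exists (\matrix_(a, c) (c == 0)%:R).
    have MM : (\matrix_(a < 2 ^ 0, c < r.+1) ((c == 0)%:R : R)) *m
        (\matrix_(a < 2 ^ 0, c < r.+1) ((c == 0)%:R : R))^T = 1%:M.
      apply/matrixP => -[[|//] i0] [[|//] j0]; rewrite !mxE.
      rewrite (bigD1 0)//= big1 ?addr0 => [|c /negbTE c0]; rewrite !mxE ?c0 ?mul0r//.
      by rewrite mulr1.
    split=> //; rewrite ?/partial_isometry ?MM ?mul1mx//.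
    by move=> d0'; rewrite -d0' in d0.
  - rewrite {}/P; move: (q.+1) qd => {}q ->.
    (* [2 ^ (d - d)] is not convertible to 1, so the single column of [unfolding d X] is reached
       through the all-ones row [u]. *)
    pose u : 'rV[R]_(2 ^ (d - d)) := const_mx 1.
    have uu : u *m u^T = 1%:M.
      apply/matrixP => i j; rewrite !ord1 !mxE.
      under eq_bigr do rewrite !mxE mulr1.
      by rewrite sumr_const card_ord subnn.
    have XE : unfolding d X = vec X *m u.
      apply/matrixP => a b; rewrite unfoldingE mxE big_ord1 !mxE mulr1.
      have -> : nat_of_ord b = 0%N.
        by case: b => b /=; rewrite subnn; case: b.
      by rewrite muln0 addn0.
    have MMx : vec X *m e *m (vec X *m e)^T *m vec X = vec X.
      rewrite trmx_mul mulmxA -[vec X *m e *m e^T]mulmxA ee mulmx1.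
      by rewrite -mulmxA xx mulmx1.
    exists (vec X *m e); split.
    + by move=> d00; rewrite d00 in d0.
    + by rewrite /partial_isometry mulmxA MMx.
    + by rewrite XE mulmxA MMx.
    + move=> _; exists (u^T *m e).
      by rewrite XE mulmxA -[vec X *m u *m _]mulmxA uu mulmx1.
    + by move=> _ a; rewrite mxE big_ord1 !mxE mulr1.
  - have [|W WE] := @colspace_frame _ _ _ r.+1 (unfolding q.+1 X).
      apply: rX; rewrite /tt_rank; apply/mapP; exists q.+1 => //.
      by rewrite mem_iota; lia.
    exists (unfolding q.+1 X *m W); split => //.
    + by rewrite /partial_isometry mulmxA WE.
    + by move=> _; exists W.
    + by move=> qd'; rewrite qd' ltnn in qd.
(* The default value 0 beyond [d] makes the family of frames total. *)
have PE' q : exists M, (q <= d)%N -> P q M.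
  have [qd|qd] := leqP q d; first by have [M PM] := PE _ qd; exists M.
  by exists 0.
pose Q q := sval (cid (PE' q)).
have PQ q : (q <= d)%N -> P q (Q q) by rewrite /Q; case: cid.
exists Q; split.
- by have [+ _ _ _ _] := PQ 0%N isT; exact.
- by move=> q /PQ[].
- move=> q i qd.
  have [_ _ QX _ _] := PQ _ (ltnW qd).
  have [_ _ _ /(_ isT)[W ->] _] := PQ _ qd.
  have [f fE] := row_half_unfolding X i qd.
  by rewrite row_half_mul mulmxA fE mulmx_colsub QX.
- have [_ _ _ _ /(_ erefl) QX] := PQ _ (leqnn d).
  by rewrite -colE; apply/colP => a; rewrite mxE QX mxE.
Qed.

Section Frames.
Variables (d r : nat) (X : tensor R d) (Q : forall q, 'M[R]_(2 ^ q, r.+1)).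
Hypothesis XQ : tt_frames X Q.

Lemma row_half_core q i : (q < d)%N ->
  row_half i (Q q.+1) = Q q *m core Q q i.
Proof. by case: XQ => _ _ H _ qd; rewrite /core mulmxA H. Qed.

(** The cores stacked over [i] arise from the contraction [Q q.+1] by applying the contraction
    [(Q q)^T] to each half. *)
Lemma core_contraction q (y : 'cV[R]_r.+1) : (q < d)%N ->
  \sum_i l2norm (core Q q i *m y) ^+ 2 <= l2norm y ^+ 2.
Proof.
case: XQ => _ QQ _ _ qd.
apply: (@le_trans _ _ (l2norm (Q q.+1 *m y) ^+ 2)).
  rewrite l2norm_row_half; apply: ler_sum => i _.
  rewrite /core row_half_mul -mulmxA.
  rewrite ler_pXn2r ?nnegrE ?l2norm_ge0//; apply: partial_isometry_le.
  exact: partial_isometry_tr (QQ _ (ltnW qd)).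
by rewrite ler_pXn2r ?nnegrE ?l2norm_ge0//; apply: partial_isometry_le; exact: QQ.
Qed.

Lemma core_sqr_le q : (q < d)%N ->
  \sum_i \sum_b \sum_c core Q q i b c ^+ 2 <= r.+1%:R.
Proof.
move=> qd.
have -> : \sum_i \sum_b \sum_c core Q q i b c ^+ 2 =
    \sum_c \sum_i l2norm (core Q q i *m delta_mx c 0) ^+ 2.
  rewrite [RHS]exchange_big; apply: eq_bigr => i _/=.
  rewrite exchange_big; apply: eq_bigr => c _/=.
  by rewrite l2norm_sqr; apply: eq_bigr => b _; rewrite -colE !mxE.
apply: (@le_trans _ _ (\sum_(c < r.+1) 1)); last by rewrite sumr_const card_ord.
apply: ler_sum => c _; apply: le_trans (core_contraction _ qd) _.
by rewrite l2norm_delta expr1n.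
Qed.

End Frames.

Definition core_dist r (Q Q' : forall q, 'M[R]_(2 ^ q, r.+1)) q : R :=
  Num.sqrt (\sum_i \sum_b \sum_c (core Q q i b c - core Q' q i b c) ^+ 2).

(** The cores are exchanged one mode at a time. Each exchange costs the Frobenius distance of the
    two cores, since what stands to its left and to its right is a contraction. *)
Lemma tt_frames_dist d r (X X' : tensor R d) (Q Q' : forall q, 'M[R]_(2 ^ q, r.+1)) :
  tt_frames X Q -> tt_frames X' Q' ->
  l2norm (vec X - vec X') <= \sum_(p < d) core_dist Q Q' p.
Proof.
move=> XQ XQ'.
(* The vector [y] is arbitrary so that the induction can absorb the cores on the right. *)
suff H q (y : 'cV[R]_r.+1) : (q <= d)%N ->
    l2norm ((Q q - Q' q) *m y) <= (\sum_(p < q) core_dist Q Q' p) * l2norm y.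
  case: (XQ) (XQ') => _ _ _ <- [_ _ _ <-]; rewrite -mulmxBl.
  apply: le_trans (H _ _ _) _ => //.
  by rewrite l2norm_delta mulr1.
elim: q y => [|q IHq] y qd.
  case: XQ XQ' => -> _ _ _ [-> _ _ _].
  rewrite subrr mul0mx big_ord0 mul0r.
  by have /eqP -> : l2norm (0 : 'cV[R]_(2 ^ 0)) == 0 by rewrite l2norm_eq0.
set S := \sum_(p < q) _ in IHq.
(* In [u] the left interface changes, which the induction hypothesis controls; in [v] only the core
   changes. *)
pose u := stack_rows (fun i => (Q q - Q' q) *m (core Q' q i *m y)).
pose v := stack_rows (fun i => Q q *m ((core Q q i - core Q' q i) *m y)).
have -> : (Q q.+1 - Q' q.+1) *m y = u + v.
  apply: row_half_inj => i.
  rewrite row_half_mul row_halfB row_halfD.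
  rewrite (row_half_core XQ)// (row_half_core XQ')// !row_half_stack.
  by rewrite !(mulmxBl, mulmxBr, mulmxA) [RHS]addrC addrA subrK.
apply: le_trans (ler_l2normD _ _) _.
rewrite big_ord_recr/= -/S mulrDl; apply: lerD.
  have S0 : 0 <= S by apply: sumr_ge0 => p _; exact: sqrtr_ge0.
  rewrite -(@ler_pXn2r _ 2) ?nnegrE ?mulr_ge0 ?l2norm_ge0// l2norm_row_half.
  apply: (@le_trans _ _ (\sum_i (S ^+ 2 * l2norm (core Q' q i *m y) ^+ 2))).
    apply: ler_sum => i _; rewrite row_half_stack -exprMn.
    rewrite ler_pXn2r ?nnegrE ?mulr_ge0 ?l2norm_ge0//.
    by apply: IHq; exact: ltnW.
  rewrite -mulr_sumr exprMn ler_wpM2l ?sqr_ge0//.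
  exact: core_contraction XQ' _ _ _.
rewrite -(@ler_pXn2r _ 2) ?nnegrE ?mulr_ge0 ?sqrtr_ge0// exprMn.
rewrite l2norm_row_half sqr_sqrtr; last first.
  by do 3![apply: sumr_ge0 => ? _]; exact: sqr_ge0.
rewrite mulr_suml; apply: ler_sum => i _; rewrite row_half_stack.
case: (XQ) => _ QQ _ _.
apply: (@le_trans _ _ (l2norm ((core Q q i - core Q' q i) *m y) ^+ 2)).
  rewrite ler_pXn2r ?nnegrE ?l2norm_ge0//; apply: partial_isometry_le.
  by apply: QQ; exact: ltnW.
apply: le_trans (l2norm_mulmx_le _ _) _.
rewrite ler_wpM2r ?sqr_ge0//.
by apply: ler_sum => b _; apply: ler_sum => c _; rewrite !mxE.
Qed.

End TensorTrain.

(** * Counting integer codes and building the net *)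

Section Net.
Variable R : realType.

Lemma sum_geometric_le (x : R) n : 0 <= x < 1 ->
  \sum_(k < n) x ^+ k <= (1 - x)^-1.
Proof.
move=> /andP[x0 x1]; rewrite -[leRHS]mul1r ler_pdivlMr ?subr_gt0//.
have := subrX1 x n; have := exprn_ge0 n x0; set s := \sum_(_ < _) _; lra.
Qed.

(* Markov's inequality for the weight [expR (- \sum_i (f i).2 / M)], whose
   total mass factors into geometric series. *)
Lemma card_small_codes (I : finType) L (M : R) : 0 < M ->
  #|[pred f : {ffun I -> bool * 'I_L} |
      \sum_i (f i).2%:R <= M * #|I|%:R]|%:R <=
  (2 * expR 1 * (M + 1)) ^+ #|I|.
Proof.
move=> M0; set F := [pred f | _].
pose w (p : bool * 'I_L) : R := expR (- (p.2%:R / M)).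
have wsum : \sum_p w p <= 2 * (M + 1).
  rewrite -(pair_bigA _ (fun b k => w (b, k)))/= big_bool/=.
  have -> : \sum_(k < L) w (true, k) = \sum_(k < L) w (false, k) by [].
  suff wf : \sum_(k < L) w (false, k) <= M + 1 by rewrite mulr_natl mulr2n lerD.
  have -> : \sum_(k < L) w (false, k) = \sum_(k < L) expR (- M^-1) ^+ k.
    by apply: eq_bigr => k _; rewrite -expRM_natl/= mulrN.
  (* Since [expR M^-1 >= 1 + M^-1], the ratio is at most [M / (M + 1)] and the geometric series at
     most [M + 1]. *)
  have xM : expR (- M^-1) <= M / (M + 1).
    rewrite expRN invf_ple ?posrE ?expR_gt0 ?divr_gt0 ?addr_gt0//.
    apply: le_trans (expR_ge1Dx _); rewrite invf_div mulrDl divff ?gt_eqF//.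
    by rewrite mul1r.
  have M1 : 0 < M + 1 by rewrite addr_gt0.
  have x1 : expR (- M^-1) < 1 by rewrite expR_lt1 oppr_lt0 invr_gt0.
  apply: le_trans (sum_geometric_le _ _) _; first by rewrite expR_ge0.
  rewrite invf_ple ?posrE ?subr_gt0//.
  apply: le_trans (_ : 1 - M / (M + 1) <= _); last by rewrite lerD2l lerN2.
  rewrite le_eqVlt; apply/orP; left; apply/eqP.
  by field; rewrite gt_eqF.
have -> : (2 * expR 1 * (M + 1)) ^+ #|I| =
    (2 * (M + 1)) ^+ #|I| * expR (#|I|%:R).
  by rewrite -[#|I|%:R]mulr1 expRM_natl -exprMn mulrAC.
rewrite -ler_pdivrMr ?expR_gt0// -expRN.
apply: le_trans (_ : \prod_(i : I) \sum_p w p <= _); last first.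
  rewrite prodr_const; apply: lerXn2r => //.
    by rewrite nnegrE sumr_ge0// => p _; exact: expR_ge0.
  by rewrite nnegrE mulr_ge0// addr_ge0// ltW.
have -> : #|F|%:R = \sum_(f in F) 1 :> R by rewrite sumr_const.
rewrite bigA_distr_bigA/= mulr_suml.
apply: le_trans (_ : \sum_(f in F) \prod_i w (f i) <= _); last first.
  rewrite [leRHS](bigID (mem F))/= lerDl sumr_ge0// => f _.
  by apply: prodr_ge0 => i _; exact: expR_ge0.
apply: ler_sum => f; rewrite inE mul1r => fF.
rewrite -expR_sum ler_expR sumrN lerN2 -mulr_suml.
by rewrite ler_pdivrMr// mulrC.
Qed.

(** Equal truncations put the absolute values in one interval of length [h]; the sign bit transfers
    this to [a] and [b]. *)
Lemma same_code_dist (a b h : R) : 0 < h -> (a < 0) = (b < 0) ->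
  Num.truncn (`|a| / h) = Num.truncn (`|b| / h) -> (a - b) ^+ 2 <= h ^+ 2.
Proof.
move=> h0 sab tab.
have := truncn_itv (divr_ge0 (normr_ge0 a) (ltW h0)).
have := truncn_itv (divr_ge0 (normr_ge0 b) (ltW h0)).
rewrite tab; move: (Num.truncn _) => k.
rewrite -natr1 !ler_pdivlMr// !ltr_pdivrMr// => /andP[b1 b2] /andP[a1 a2].
suff : `|a - b| <= h.
  by move=> abh; rewrite -real_normK ?num_real// lerXn2r ?nnegrE// ltW.
rewrite ler_norml; move: a1 a2 b1 b2; rewrite mulrDl mul1r.
case: (ltrP a 0) sab => [a0 /esym b0|a0 /esym /negbT].
  by rewrite !ltr0_norm//; move: (k%:R * h) => z; lra.
by rewrite -leNgt => b0; rewrite !ger0_norm//; move: (k%:R * h) => z; lra.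
Qed.

Lemma sqr_sum_le (I : finType) (f : I -> R) :
  (\sum_i f i) ^+ 2 <= #|I|%:R * \sum_i f i ^+ 2.
Proof.
have := cauchy_schwarz_sum (fun=> 1) f.
by under eq_bigr do rewrite mul1r; rewrite expr1n sumr_const.
Qed.

Lemma sum_core_index d r (F : nat -> 'I_2 -> 'I_r -> 'I_r -> R) :
  \sum_(p : 'I_d * ('I_2 * ('I_r * 'I_r))) F p.1 p.2.1 p.2.2.1 p.2.2.2 =
  \sum_(q < d) \sum_i \sum_b \sum_c F q i b c.
Proof.
rewrite -(pair_bigA _ (fun (q : 'I_d) p => F q p.1 p.2.1 p.2.2))/=.
apply: eq_bigr => q _.
rewrite -(pair_bigA _ (fun i p => F q i p.1 p.2))/=.
by apply: eq_bigr => i _; rewrite -(pair_bigA _ (fun b c => F q i b c)).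
Qed.

Lemma tt_net d r (eta : R) (U : set (tensor R d)) : (0 < d)%N -> 0 < eta ->
  (forall X, U X -> frob_norm X = 1 /\ all (fun p => p <= r.+1)%N (tt_rank X)) ->
  exists s : seq (tensor R d),
  [/\ forall X, X \in s -> U X,
      (size s)%:R <= (2 * expR 1 * (d%:R * Num.sqrt r.+1%:R / eta + 1)) ^+
                     (2 * d * r.+1 ^ 2)
    & forall X, U X ->
        exists2 X0, X0 \in s & l2norm (vec X - vec X0) <= eta].
Proof.
move=> d0 eta0 UX.
have frames X : exists Q, U X -> @tt_frames _ d r X Q.
  have [/UX[X1 rX]|nX] := pselect (U X); last by exists (fun=> 0).
  by have [Q XQ] := tt_frames_exist d0 X1 rX; exists Q.
pose Q X := sval (cid (frames X)).
have XQ X : U X -> tt_frames X (Q X) by rewrite /Q; case: cid.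
pose I : finType := ('I_d * ('I_2 * ('I_r.+1 * 'I_r.+1)))%type.
pose n := #|{: I}|.
have nE : n = (2 * d * r.+1 ^ 2)%N.
  by rewrite /n !card_prod !card_ord; lia.
have n0 : (0 < n)%N by rewrite nE !muln_gt0 d0.
pose theta X (p : I) := core (Q X) p.1 p.2.1 p.2.2.1 p.2.2.2.
(* Rounding errors of size [h] in [n] entries have Euclidean norm [sqrt n * h], and summing over [d]
   modes by Cauchy-Schwarz costs a factor [sqrt d]: the total is [eta]. *)
pose h := eta / (Num.sqrt d%:R * Num.sqrt n%:R).
have sd0 : 0 < Num.sqrt d%:R :> R by rewrite sqrtr_gt0 ltr0n.
have sn0 : 0 < Num.sqrt n%:R :> R by rewrite sqrtr_gt0 ltr0n.
have h0 : 0 < h by rewrite divr_gt0// mulr_gt0.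
pose M : R := d%:R * Num.sqrt r.+1%:R / eta.
have M0 : 0 < M by rewrite divr_gt0// mulr_gt0 ?ltr0n// sqrtr_gt0 ltr0n.
(* The bound on the sum of the magnitudes bounds each of them, so [inord] loses nothing on [U]. *)
pose L := Num.truncn (M * n%:R).
pose mag X p := Num.truncn (`|theta X p| / h).
pose code X : {ffun I -> bool * 'I_L.+1} :=
  [ffun p => (theta X p < 0, inord (mag X p))].
(* The [l^1] norm of [theta X] is at most [sqrt n] times its Euclidean norm, itself at most
   [sqrt (d * r.+1)]; division by [h] gives [M * n]. *)
have magM X : U X -> \sum_p (mag X p)%:R <= M * n%:R.
  move=> /XQ Xf.
  apply: le_trans (_ : \sum_p (`|theta X p| / h) <= _).
    by apply: ler_sum => p _; rewrite truncn_le divr_ge0// ltW.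
  rewrite -mulr_suml ler_pdivrMr//.
  have th2 : \sum_p theta X p ^+ 2 <= d%:R * r.+1%:R.
    rewrite (sum_core_index d (fun q i b c => core (Q X) q i b c ^+ 2)).
    apply: le_trans (_ : \sum_(q < d) r.+1%:R <= _).
      by apply: ler_sum => q _; exact: core_sqr_le Xf _ (ltn_ord q).
    by rewrite sumr_const card_ord mulr_natl.
  rewrite -(@ler_pXn2r _ 2) ?nnegrE ?sumr_ge0//; last first.
    by rewrite !mulr_ge0// ?ltW// ?invr_gt0.
  apply: le_trans (sqr_sum_le _) _.
  under eq_bigr do rewrite real_normK ?num_real//.
  have -> : (M * n%:R * h) ^+ 2 = n%:R * (d%:R * r.+1%:R).
    have -> : M * n%:R * h =
        (Num.sqrt d%:R) * Num.sqrt r.+1%:R * Num.sqrt n%:R.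
      rewrite /M /h -{1}(sqr_sqrtr (ler0n R d)) -{1}(sqr_sqrtr (ler0n R n)).
      by field; rewrite !gt_eqF.
    by rewrite !exprMn !sqr_sqrtr//; ring.
  by rewrite ler_wpM2l.
have magL Y p : U Y -> (mag Y p < L.+1)%N.
  move=> /magM YM; rewrite ltnS /L truncn_ge_nat; last first.
    by rewrite mulr_ge0// ltW.
  apply: le_trans YM; rewrite (bigD1 p)//= lerDl sumr_ge0//.
have code_dist X X' : U X -> U X' -> code X = code X' ->
    l2norm (vec X - vec X') <= eta.
  move=> UX1 UX2 /ffunP cXX'.
  apply: le_trans (tt_frames_dist (XQ _ UX1) (XQ _ UX2)) _.
  rewrite -(@ler_pXn2r _ 2) ?nnegrE ?(ltW eta0)//; last first.
    by apply: sumr_ge0 => p _; exact: sqrtr_ge0.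
  apply: le_trans (sqr_sum_le _) _; rewrite card_ord.
  have -> : eta ^+ 2 = d%:R * (n%:R * h ^+ 2).
    rewrite /h expr_div_n exprMn !sqr_sqrtr//.
    by field; rewrite !pnatr_eq0 -!lt0n d0 n0.
  rewrite ler_wpM2l//.
  under eq_bigr => q _.
    rewrite sqr_sqrtr; last by do 3![apply: sumr_ge0 => ? _]; exact: sqr_ge0.
    over.
  rewrite -(sum_core_index d
    (fun q i b c => (core (Q X) q i b c - core (Q X') q i b c) ^+ 2)).
  apply: le_trans (_ : \sum_(p : I) h ^+ 2 <= _).
    apply: ler_sum => p _; apply: same_code_dist => //.
      by have := cXX' p; rewrite !ffunE => -[].
    have := cXX' p; rewrite !ffunE => -[_] /(congr1 val).
    by rewrite /= !inordK ?magL.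
  by rewrite sumr_const mulr_natl.
pose rep f : option (tensor R d) :=
  if pselect (exists X, U X /\ code X = f) is left e
  then Some (sval (cid e)) else None.
have repP f X : rep f = Some X -> U X /\ code X = f.
  by rewrite /rep; case: pselect => // e [<-]; case: cid.
pose F := [pred f : {ffun I -> bool * 'I_L.+1} | \sum_p (f p).2%:R <= M * n%:R].
exists (pmap rep (enum F)); split.
- move=> X; rewrite mem_pmap => /mapP[f _ /esym/repP[]//].
- rewrite -nE; apply: le_trans (card_small_codes I L.+1 M0).
  by rewrite ler_nat size_pmap cardE; exact: count_size.
- move=> X UX1; pose f := code X.
  have [X0 X0E] : exists X0, rep f = Some X0.
    rewrite /rep; case: pselect => [e|]; first by exists (sval (cid e)).
    by case; exists X.
  have [UX0 cX0] := repP _ _ X0E.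
  exists X0; last by apply: code_dist.
  rewrite mem_pmap -X0E map_f// mem_enum /F !inE.
  under eq_bigr do rewrite ffunE/= inordK ?magL//.
  exact: magM.
Qed.

End Net.

(** * Chernoff bounds by counting sample functions *)

Section Sampling.
Variable R : realType.

(** Squaring [expR (u / 2) <= (1 - u / 2)^-1] leaves a polynomial inequality. *)
Lemma expR_le_quadratic (u : R) : `|u| <= 4^-1 -> expR u <= 1 + u + u ^+ 2.
Proof.
rewrite ler_norml => /andP[u1 u2].
have v0 : 0 < 1 - u / 2 by lra.
have -> : expR u = expR (u / 2) ^+ 2 by rewrite -expRM_natl mulrC divfK.
have : expR (u / 2) <= (1 - u / 2)^-1.
  rewrite -[u / 2]opprK expRN lef_pV2 ?posrE ?expR_gt0 ?opprK//.
  exact: expR_ge1Dx.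
move=> h; apply: le_trans (_ : (1 - u / 2)^-1 ^+ 2 <= _).
  by rewrite lerXn2r ?nnegrE ?expR_ge0// invr_ge0 ltW.
rewrite exprVn -[leLHS]mul1r ler_pdivrMr ?exprn_gt0//.
rewrite -subr_ge0.
have -> : (1 + u + u ^+ 2) * (1 - u / 2) ^+ 2 - 1 =
  (u / 2) ^+ 2 * (1 - 3 * u + u ^+ 2) by field.
by rewrite mulr_ge0 ?sqr_ge0//; have := sqr_ge0 u; lra.
Qed.

Lemma expR_chord (u z : R) : 0 <= z <= 1 -> expR (u * z) <= 1 + z * (expR u - 1).
Proof.
move=> /andP[z0 z1].
have := @convex_expR R (Itv01 z0 z1) u 0.
rewrite !convRE/= expR0 mulr0 addr0 mulr1 [z * u]mulrC => /le_trans; apply.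
by rewrite le_eqVlt; apply/orP; left; apply/eqP; rewrite /unstable.onem; ring.
Qed.

Section Chernoff.
Variables (J : finType) (B : R) (f : J -> R) (m : nat).
Hypotheses (B0 : 0 < B) (f01 : forall j, 0 <= f j <= B).
Hypothesis f_mean : \sum_j f j = #|J|%:R.

(** The chord bound on [[0, 1]] is linear in [f j / B], so its sum involves only the mean of [f];
    [1 + x <= expR x] then restores an exponential. *)
Lemma mgf_le u : `|u| <= 4^-1 ->
  \sum_j expR (u * (f j / B)) <= #|J|%:R * expR ((u + u ^+ 2) / B).
Proof.
move=> u4.
apply: le_trans (_ : \sum_j (1 + (f j / B) * (expR u - 1)) <= _).
  apply: ler_sum => j _; apply: expR_chord.
  have /andP[fj0 fjB] := f01 j.
  by rewrite divr_ge0 ?(ltW B0)//= ler_pdivrMr// mul1r.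
rewrite big_split/= sumr_const -mulr_suml -mulr_suml f_mean.
rewrite (_ : 1 *+ _ + _ = #|J|%:R * (1 + (expR u - 1) / B)); last by ring.
rewrite ler_wpM2l//; apply: le_trans (expR_ge1Dx _) _.
rewrite ler_expR ler_pM2r ?invr_gt0//.
by have := expR_le_quadratic u4; lra.
Qed.

(* Exponential Markov inequality; the sign of [u] selects the upper or the lower
   tail. *)
Lemma card_tail_le u a : `|u| <= 4^-1 ->
  #|[pred nu : {ffun 'I_m -> J} | u * a <= u * \sum_l f (nu l)]|%:R <=
  #|J|%:R ^+ m * expR ((m%:R * (u + u ^+ 2) - u * a) / B).
Proof.
move=> u4; set E := [pred nu | _].
rewrite mulrBl expRD mulrA expRN -ler_pdivrMr ?invr_gt0 ?expR_gt0// invrK.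
rewrite -[in leRHS]mulrA expRM_natl -exprMn.
apply: le_trans (_ : (\sum_j expR (u * (f j / B))) ^+ m <= _); last first.
  apply: lerXn2r (mgf_le u4); rewrite nnegrE.
    by apply: sumr_ge0 => j _; exact: expR_ge0.
  by rewrite mulr_ge0// expR_ge0.
rewrite -[X in _ ^+ X](card_ord m) -prodr_const bigA_distr_bigA/=.
have -> : #|E|%:R = \sum_(nu in E) 1 :> R by rewrite sumr_const.
rewrite mulr_suml.
apply: le_trans (_ : \sum_(nu in E) \prod_l expR (u * (f (nu l) / B)) <= _); last first.
  rewrite [leRHS](bigID (mem E))/= lerDl sumr_ge0// => nu _.
  by apply: prodr_ge0 => l _; exact: expR_ge0.
apply: ler_sum => nu; rewrite inE mul1r => nuE.
rewrite -expR_sum ler_expR -mulr_sumr -mulr_suml mulrA.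
by rewrite ler_pM2r ?invr_gt0.
Qed.

Lemma card_deviation_le t : 0 <= t <= 2^-1 ->
  #|[pred nu : {ffun 'I_m -> J} | m%:R * t < `|\sum_l f (nu l) - m%:R|]|%:R <=
  2 * #|J|%:R ^+ m * expR (- (m%:R * t ^+ 2 / (4 * B))).
Proof.
move=> /andP[t0 t1].
(* The value [u = t / 2] minimizes [u ^+ 2 - u * t], giving [- t ^+ 2 / 4]; the lower tail takes the
   opposite [u]. *)
have up : `|t / 2| <= 4^-1 by rewrite ger0_norm; lra.
have dn : `|- (t / 2)| <= 4^-1 by rewrite normrN.
have Hu := card_tail_le (m%:R * (1 + t)) up.
have Hd := card_tail_le (m%:R * (1 - t)) dn.
rewrite (_ : _ / B = - (m%:R * t ^+ 2 / (4 * B))) in Hu; last first.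
  by field; rewrite gt_eqF.
rewrite (_ : _ / B = - (m%:R * t ^+ 2 / (4 * B))) in Hd; last first.
  by field; rewrite gt_eqF.
rewrite -[leRHS]mulrA [leRHS]mulr_natl [leRHS]mulr2n.
apply: le_trans (lerD Hu Hd).
rewrite -natrD ler_nat -cardUI; apply: leq_trans (leq_addr _ _).
apply: subset_leq_card; apply/fintype.subsetP => nu; rewrite !inE => H.
have t20 : 0 <= t / 2 by lra.
rewrite !mulNr lerN2; apply/orP; move: H.
case: (ler0P (\sum_l f (nu l) - m%:R)) => _ H; [right|left];
  by apply: ler_wpM2l => //; lra.
Qed.

End Chernoff.

(** By independence, each atom fixing all [m] samples has probability [1 / n ^ m], and the event is
    a finite disjoint union of atoms. Probabilities thereby reduce to cardinals. *)
Lemma iid_uniform_prob (disp : measure_display) (T : measurableType disp)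
    (P : probability T R) (m n : nat) (nu : 'I_m -> T -> 'I_n)
    (E : pred {ffun 'I_m -> 'I_n}) : iid_uniform P nu ->
  P [set w | E [ffun l => nu l w]] = (#|E|%:R / n%:R ^+ m)%:E.
Proof.
move=> [nu_meas nu_unif nu_indep].
pose A (g : {ffun 'I_m -> 'I_n}) :=
  \bigcap_(l in [set` [set: 'I_m]%SET]) (nu l @^-1` [set g l]).
have AE g w : A g w <-> [ffun l => nu l w] = g.
  split=> [Ag|<- l _]; last by rewrite /= ffunE.
  by apply/ffunP => l; rewrite ffunE; apply: Ag; rewrite /= inE.
have PA g : P (A g) = ((n%:R ^+ m)^-1)%:E.
  rewrite /A (nu_indep [set: 'I_m]%SET (fun l => [set g l])).
  rewrite (eq_bigr (fun=> (n%:R^-1)%:E)) => [|l _]; last exact: nu_unif.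
  rewrite prodEFin; congr (_%:E); rewrite prodr_const cardsT card_ord.
  by rewrite exprVn.
have -> : [set w | E [ffun l => nu l w]] = \bigcup_(g in [set` E]) A g.
  apply/seteqP; split=> [w Ew|w [g Eg /AE wg]] /=; last by rewrite wg.
  by exists [ffun l => nu l w] => //; apply/AE.
rewrite measure_fin_bigcup//.
- rewrite -(@bigfs _ _ _ _ (index_enum {ffun 'I_m -> 'I_n}) E)//.
  + rewrite (eq_bigr (fun=> ((n%:R ^+ m)^-1)%:E)) => [|g _]; last exact: PA.
    by rewrite sumEFin sumr_const mulr_natl.
  + exact: index_enum_uniq.
  + by move=> g _; rewrite mem_index_enum.
- by move=> g g' _ _ [w [/AE <- /AE <-]].
- by move=> g _; exact: fin_bigcap_measurable.
Qed.

End Sampling.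

(** * Isometry and flatness of the Walsh-Hadamard matrix *)

Section WalshHadamard.
Variable R : realType.

Lemma tensmx1 m n : (1%:M : 'M[R]_m) *t (1%:M : 'M[R]_n) = 1%:M.
Proof.
apply/matrixP => a b; case: (mxtens_indexP a) => i j; case: (mxtens_indexP b) => i' j'.
by rewrite tensmxE !mxE -natrM mulnb (can_eq (@mxtens_indexK _ _)) xpair_eqE.
Qed.

Lemma ntensmx_isometry n (A : 'M[R]_n) k :
  A^T *m A = 1%:M -> (ntensmx A k)^T *m ntensmx A k = 1%:M.
Proof.
(* The recurrence [ntensmxSS] starts at exponent [k.+2], hence two base cases. *)
move=> AA; case: k => [|k]; first by rewrite ntensmx0 trmx1 mul1mx.
elim: k => [|k IHk]; first by rewrite ntensmx1.
by rewrite ntensmxSS trmx_tens tensmx_mul AA IHk tensmx1.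
Qed.

Lemma ntensmx_sqr_entry n (A : 'M[R]_n) (c : R) k i j :
  (forall i j, A i j ^+ 2 = c) -> ntensmx A k i j ^+ 2 = c ^+ k.
Proof.
move=> Ac; case: k => [|k] in i j *.
  by rewrite ntensmx0 expr0; case: i j => [[|//] ?] [[|//] ?]; rewrite !mxE expr1n.
elim: k => [|k IHk] in i j *; first by rewrite ntensmx1 expr1; exact: Ac.
rewrite ntensmxSS; case: (mxtens_indexP i) => i1 i2; case: (mxtens_indexP j) => j1 j2.
by rewrite tensmxE exprMn Ac IHk -exprS.
Qed.

Lemma hadamard2_isometry : (hadamard2 R)^T *m hadamard2 R = 1%:M.
Proof.
have s2 : (Num.sqrt 2)^-1 * (Num.sqrt 2)^-1 = 2^-1 :> R.
  by rewrite -invfM -expr2 sqr_sqrtr.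
apply/matrixP => -[[|[|//]] i0] [[|[|//]] j0];
  rewrite !mxE !big_ord_recl big_ord0 !mxE/= ?mulr1 ?mulrN1 ?mulNr ?mulrN s2; lra.
Qed.

Lemma hadamard2_sqr_entry i j : hadamard2 R i j ^+ 2 = 2^-1.
Proof.
by rewrite !mxE exprMn exprVn sqr_sqrtr//; case: ifP; rewrite ?sqrrN expr1n mulr1.
Qed.

Definition supp_size n (x : 'cV[R]_n) := #|[pred i | x i 0 != 0]|.

Lemma supp_sizeD n (x y : 'cV[R]_n) :
  (supp_size (x + y) <= supp_size x + supp_size y)%N.
Proof.
rewrite -cardUI; apply: leq_trans (leq_addr _ _); apply: subset_leq_card.
apply/fintype.subsetP => i; rewrite !inE mxE.
by apply: contraR; rewrite negb_or !negbK => /andP[/eqP-> /eqP->]; rewrite addr0.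
Qed.

Lemma supp_sizeN n (x : 'cV[R]_n) : supp_size (- x) = supp_size x.
Proof. by apply: eq_card => i; rewrite !inE mxE oppr_eq0. Qed.

Lemma supp_sizeZ n a (x : 'cV[R]_n) : (supp_size (a *: x) <= supp_size x)%N.
Proof.
apply: subset_leq_card; apply/fintype.subsetP => i; rewrite !inE mxE.
by rewrite mulf_eq0 negb_or => /andP[].
Qed.

Variable d : nat.
Local Notation H := (walsh_hadamard R d).

Lemma l2norm_walsh_hadamard (x : 'cV[R]_(2 ^ d)) : l2norm (H *m x) = l2norm x.
Proof.
apply/eqP; rewrite -(@eqrXn2 _ 2) ?l2norm_ge0// !l2norm_dot trmx_mul.
rewrite mulmxA -[_ *m H^T *m H]mulmxA ntensmx_isometry ?mulmx1//.
exact: hadamard2_isometry.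
Qed.

(** Cauchy-Schwarz with the row of [H] restricted to the support of [x]: its entries there have
    square [2 ^ - d], which cancels the factor [2 ^ d]. *)
Lemma walsh_hadamard_flat (x : 'cV[R]_(2 ^ d)) j :
  (2 ^ d)%:R * (H *m x) j 0 ^+ 2 <= (supp_size x)%:R * l2norm x ^+ 2.
Proof.
pose y i := H j i * (x i 0 != 0)%:R.
rewrite mxE (eq_bigr (fun i => y i * x i 0)); last first.
  by move=> i _; rewrite /y; have [->|] := eqVneq (x i 0) 0; rewrite ?mulr0// mulr1.
rewrite l2norm_sqr.
apply: le_trans (_ : (2 ^ d)%:R * ((\sum_i y i ^+ 2) * (\sum_i x i 0 ^+ 2)) <= _).
  by rewrite ler_wpM2l//; exact: cauchy_schwarz_sum.
rewrite mulrA ler_wpM2r ?sumr_ge0//; first by move=> i _; exact: sqr_ge0.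
have -> : \sum_i y i ^+ 2 = (supp_size x)%:R * (2^-1) ^+ d.
  rewrite (eq_bigr (fun i => if x i 0 != 0 then (2^-1) ^+ d else 0)) => [|i _].
    by rewrite -big_mkcond/= sumr_const mulr_natl.
  rewrite /y exprMn (ntensmx_sqr_entry _ _ hadamard2_sqr_entry).
  by case: (x i 0 != 0); rewrite /= ?expr0n ?expr1n ?mulr1 ?mulr0.
by rewrite natrX mulrCA -exprMn mulfV// expr1n mulr1.
Qed.

Lemma l2norm_measurement m (nu : 'I_m -> 'I_(2 ^ d)) (X : tensor R d) :
  l2norm (measurement nu X) ^+ 2 =
  (\sum_l (2 ^ d)%:R * (H *m vec X) (nu l) 0 ^+ 2) / m%:R.
Proof.
rewrite /measurement /measurement_mx -scalemxAl l2normZ exprMn.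
rewrite real_normK ?num_real// sqr_sqrtr ?divr_ge0// l2norm_sqr -mulmxA.
under eq_bigr do rewrite samplingE.
by rewrite -mulr_sumr mulrAC.
Qed.

End WalshHadamard.

(** * Sparsity of low-order tensors *)

Section LowOrder.
Variables (R : realType) (d : nat).

Definition set_index (S : {set 'I_d}) : multi_index d :=
  [ffun p => if p \in S then ord_max else ord0].

Lemma span_basis_tensor_supp (A : {set {set 'I_d}}) (Y : tensor R d) i :
  Y \in <<[seq basis_tensor R U | U : {set 'I_d} in A]>>%VS -> Y i != 0 ->
  i \in [seq set_index U | U : {set 'I_d} in A].
Proof.
set b := [seq _ | U in A] => /(@coord_span _ _ _ (in_tuple b)) YE.
apply: contraR => iA.
rewrite YE sum_ffunE big1// => j _; rewrite ffunE.
have /mapP[U UA ->] := mem_nth 0 (ltn_ord j : (j < size b)%N).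
rewrite ffunE; case: eqP => [iU|_]; last by rewrite scaler0.
by move/negP: iA; case; rewrite iU; apply/mapP; exists U.
Qed.

(** The binary sum [g] is a right inverse of the digit map; it is injective between sets of equal
    cardinal, hence bijective, and so is the digit map. *)
Lemma digits_inj : injective (fun j : 'I_(2 ^ d) => [ffun q : 'I_d => digit j q]).
Proof.
have lt2 (i : multi_index d) : (\sum_(q < d) i q * 2 ^ q < 2 ^ d)%N.
  rewrite -[(2 ^ d)%N]prednK ?expn_gt0// ltnS predn_exp mul1n.
  apply: leq_sum => q _; rewrite -[leqRHS]mul1n leq_mul2r; apply/orP; right.
  by rewrite -ltnS ltn_ord.
pose g (i : multi_index d) := Ordinal (lt2 i).
have gK : cancel g (fun j : 'I_(2 ^ d) => [ffun q : 'I_d => digit j q]).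
  by move=> i; apply/ffunP => q; rewrite ffunE digit_sum.
have g_bij : bijective g.
  apply: inj_card_bij; first exact: can_inj gK.
  by rewrite card_ffun !card_ord.
exact: bij_inj (bij_can_bij g_bij gK).
Qed.

(** A nonzero entry of [X] is nonzero in some [Y t], hence sits at the index of a subset of [S t],
    which has at most [2 ^ s] subsets. *)
Lemma low_order_supp_size k s (X : tensor R d) : low_order k s X ->
  (supp_size (vec X) <= k * 2 ^ s)%N.
Proof.
move=> [S [Y [Ss SY XE]]].
pose F := flatten [seq [seq set_index U | U : {set 'I_d} in powerset (S t)] | t : 'I_k].
have sF : (size F <= k * 2 ^ s)%N.
  rewrite size_flatten /shape -map_comp sumnE big_map big_enum/=.
  rewrite -[X in (_ <= X * _)%N](card_ord k) -sum_nat_const; apply: leq_sum => t _.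
  by rewrite size_map -cardE card_powerset leq_exp2l.
apply: leq_trans sF; apply: leq_trans (card_size _).
rewrite /supp_size -(card_imset _ digits_inj).
apply: subset_leq_card; apply/fintype.subsetP => _ /imsetP[j + ->].
rewrite inE mxE XE sum_ffunE; move: [ffun q : 'I_d => digit j q] => i Xi.
have [t Yt] : exists t, Y t i != 0.
  apply/existsP; apply: contraR Xi; rewrite negb_exists => /forallP Y0.
  by rewrite big1// => t _; apply/eqP; have := Y0 t; rewrite negbK.
apply/flattenP; exists [seq set_index U | U : {set 'I_d} in powerset (S t)].
  by apply/mapP; exists t; rewrite ?mem_enum.
exact: span_basis_tensor_supp (SY t) Yt.
Qed.

End LowOrder.

(** * Measured energies of normalized sparse tensors *)

Section RIP.
Variables (R : realType) (d r b : nat).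

Definition sparse_tt : set (tensor R d) :=
  [set X | [/\ frob_norm X = 1, all (fun p => p <= r.+1)%N (tt_rank X)
             & (supp_size (vec X) <= b)%N]].

Definition energy (X : tensor R d) (j : 'I_(2 ^ d)) : R :=
  (2 ^ d)%:R * (walsh_hadamard R d *m vec X) j 0 ^+ 2.

Lemma energy_bounds X j : sparse_tt X -> 0 <= energy X j <= b%:R.
Proof.
move=> [X1 _ Xb]; rewrite mulr_ge0 ?sqr_ge0//=.
apply: le_trans (walsh_hadamard_flat _ _) _.
by rewrite -/(frob_norm X) X1 expr1n mulr1 ler_nat.
Qed.

Lemma energy_sum X : sparse_tt X -> \sum_j energy X j = #|'I_(2 ^ d)|%:R.
Proof.
move=> [X1 _ _]; rewrite -mulr_sumr -l2norm_sqr l2norm_walsh_hadamard.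
by rewrite -/(frob_norm X) X1 expr1n mulr1 card_ord.
Qed.

(** A difference of squares factors through [x - x'] and [x + x'], both with at most [2 * b] nonzero
    entries. Flatness bounds each factor by [sqrt (2 * b)] times the norm, and
    [l2norm (x + x') <= 2] yields [4 * b]. *)
Lemma energy_lipschitz X X' j : sparse_tt X -> sparse_tt X' ->
  `|energy X j - energy X' j| <= 4 * b%:R * l2norm (vec X - vec X').
Proof.
move=> [X1 _ Xb] [X'1 _ X'b]; set x := vec X in Xb *; set x' := vec X' in X'b *.
pose H := walsh_hadamard R d.
have -> : energy X j - energy X' j =
    (2 ^ d)%:R * ((H *m (x - x')) j 0 * (H *m (x + x')) j 0).
  rewrite /energy -/x -/x' -/H mulmxBr mulmxDr !mxE; ring.
have Hm := walsh_hadamard_flat (x - x') j.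
have Hp := walsh_hadamard_flat (x + x') j.
rewrite -(@ler_pXn2r _ 2) ?nnegrE ?mulr_ge0 ?l2norm_ge0//.
rewrite real_normK ?num_real//.
have -> : ((2 ^ d)%:R * ((H *m (x - x')) j 0 * (H *m (x + x')) j 0)) ^+ 2 =
  ((2 ^ d)%:R * (H *m (x - x')) j 0 ^+ 2) * ((2 ^ d)%:R * (H *m (x + x')) j 0 ^+ 2).
  by ring.
apply: le_trans (ler_pM _ _ Hm Hp) _; rewrite ?(mulr_ge0 (ler0n _ _) (sqr_ge0 _))//.
have -> : (4 * b%:R * l2norm (x - x')) ^+ 2 =
  ((2 * b)%:R * l2norm (x - x') ^+ 2) * ((2 * b)%:R * 2 ^+ 2) by rewrite natrM; ring.
have supp2 (z : 'cV[R]_(2 ^ d)) : (supp_size z <= b)%N ->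
    (supp_size (x + z) <= 2 * b)%N.
  by move=> zb; rewrite mul2n -addnn; apply: leq_trans (supp_sizeD _ _) (leq_add _ _).
apply: ler_pM; rewrite ?(mulr_ge0 (ler0n _ _) (sqr_ge0 _))//.
  by rewrite ler_wpM2r ?sqr_ge0// ler_nat supp2// supp_sizeN.
apply: ler_pM; rewrite ?ler0n ?sqr_ge0//; first by rewrite ler_nat supp2.
rewrite ler_pXn2r ?nnegrE ?l2norm_ge0//.
apply: le_trans (ler_l2normD _ _) _.
by rewrite -/(frob_norm X) -/(frob_norm X') X1 X'1; lra.
Qed.

End RIP.

(** * From the net to the whole class, and the union bound *)

Section RIPOnNet.
Variables (R : realType) (d r b : nat).
Implicit Types X : tensor R d.

Lemma normalize_sparse_tt X : frob_norm X != 0 ->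
  all (fun p => p <= r.+1)%N (tt_rank X) -> (supp_size (vec X) <= b)%N ->
  exists2 X' : tensor R d, sparse_tt r b X' & vec X = frob_norm X *: vec X'.
Proof.
move=> X0 rX bX; pose X' : tensor R d := [ffun i => (frob_norm X)^-1 * X i].
have vX' : vec X' = (frob_norm X)^-1 *: vec X.
  by apply/colP => j; rewrite !mxE ffunE.
exists X'; last by rewrite vX' scalerA mulfV// scale1r.
split.
- by rewrite {1}/frob_norm vX' l2normZ ger0_norm ?invr_ge0 ?l2norm_ge0// mulVf.
- apply/allP => _ /mapP[q qd ->]; move/allP: rX => /(_ (\rank (unfolding q X))).
  rewrite map_f// => /(_ isT); apply: leq_trans.
  have -> : unfolding q X' = (frob_norm X)^-1 *: unfolding q X.
    by apply/matrixP => a c; rewrite !mxE ffunE.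
  exact: mxrankS (scalemx_sub _ (submx_refl _)).
- by rewrite vX'; apply: leq_trans (supp_sizeZ _ _) bX.
Qed.

(** After normalization, half of [eps] pays for moving to a net point, as
    [4 * b * (eps / (8 * b)) = eps / 2], and half for the deviation there. *)
Lemma rip_of_net m (eps : R) (nu : 'I_m -> 'I_(2 ^ d)) (s : seq (tensor R d)) :
  (0 < m)%N -> (0 < b)%N -> 0 < eps ->
  (forall X, X \in s -> sparse_tt r b X) ->
  (forall X, sparse_tt r b X ->
     exists2 X0, X0 \in s & l2norm (vec X - vec X0) <= eps / (8 * b%:R)) ->
  (forall X, X \in s ->
     `|\sum_l energy X (nu l) - m%:R| <= m%:R * (eps / 2)) ->
  forall X, all (fun p => p <= r.+1)%N (tt_rank X) ->
    (supp_size (vec X) <= b)%N ->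
  `|l2norm (measurement nu X) ^+ 2 - frob_norm X ^+ 2| <= eps * frob_norm X ^+ 2.
Proof.
move=> m0 b0 eps0 sU net good X rX bX.
have [X0|X0] := eqVneq (frob_norm X) 0.
  have vX0 : vec X = 0 by apply/eqP; rewrite -l2norm_eq0; apply/eqP.
  have -> : l2norm (measurement nu X) = 0.
    by apply/eqP; rewrite l2norm_eq0 /measurement vX0 mulmx0.
  by rewrite X0 expr0n subr0 normr0 mulr0.
have [Y UY XY] := normalize_sparse_tt X0 rX bX.
have -> : l2norm (measurement nu X) ^+ 2 =
    frob_norm X ^+ 2 * ((\sum_l energy Y (nu l)) / m%:R).
  rewrite -(l2norm_measurement nu Y) /measurement XY -scalemxAr l2normZ exprMn.
  by rewrite real_normK ?num_real.
rewrite -[X in _ - X]mulr1 -mulrBr normrM ger0_norm ?sqr_ge0// mulrC.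
rewrite ler_wpM2r ?sqr_ge0//.
have m0' : 0 < m%:R :> R by rewrite ltr0n.
rewrite -[X in _ - X](@divff _ m%:R) ?gt_eqF// -mulrBl normrM normfV.
rewrite [`|m%:R|]ger0_norm// ler_pdivrMr//.
have [Z sZ YZ] := net Y UY; have UZ := sU _ sZ.
have -> : \sum_l energy Y (nu l) - m%:R =
    \sum_l (energy Y (nu l) - energy Z (nu l)) + (\sum_l energy Z (nu l) - m%:R).
  by rewrite sumrB; ring.
apply: le_trans (ler_normD _ _) _.
have -> : eps * m%:R = m%:R * (eps / 2) + m%:R * (eps / 2) by field.
apply: lerD; last exact: good.
apply: le_trans (ler_norm_sum _ _ _) _.
apply: le_trans (_ : \sum_(l < m) (eps / 2) <= _); last first.
  by rewrite sumr_const card_ord mulr_natl.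
apply: ler_sum => l _; apply: le_trans (energy_lipschitz _ UY UZ) _.
apply: le_trans (_ : 4 * b%:R * (eps / (8 * b%:R)) <= _).
  by rewrite ler_wpM2l// mulr_ge0.
rewrite le_eqVlt; apply/orP; left; apply/eqP.
by field; rewrite pnatr_eq0 -lt0n.
Qed.

(** Union bound by induction on the list; the deviation [eps / 2] turns the denominator [4 * b] of
    the Chernoff exponent into [16 * b]. *)
Lemma card_bad_samples m (eps : R) (s : seq (tensor R d)) :
  (0 < b)%N -> 0 <= eps <= 1 -> (forall X, X \in s -> sparse_tt r b X) ->
  #|[pred nu : {ffun 'I_m -> 'I_(2 ^ d)} |
     has (fun X => m%:R * (eps / 2) < `|\sum_l energy X (nu l) - m%:R|) s]|%:R <=
  (size s)%:R * (2 * (2 ^ d)%:R ^+ m * expR (- (m%:R * eps ^+ 2 / (16 * b%:R)))).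
Proof.
move=> b0 /andP[eps0 eps1]; elim: s => [|X s IHs] sU.
  by rewrite mul0r (eq_card (_ : _ =i pred0)) ?card0.
have UX : sparse_tt r b X by apply: sU; rewrite mem_head.
have {}IHs := IHs (fun Y sY => sU Y (mem_behead (s := X :: s) sY)).
have b0' : 0 < b%:R :> R by rewrite ltr0n.
have H := @card_deviation_le _ _ _ _ m b0' (fun j => energy_bounds j UX)
  (energy_sum UX) (eps / 2).
rewrite [(size (X :: s))%:R]mulrS mulrDl mul1r.
have {}H : #|[pred nu : {ffun 'I_m -> 'I_(2 ^ d)} |
     m%:R * (eps / 2) < `|\sum_l energy X (nu l) - m%:R|]|%:R <=
   2 * (2 ^ d)%:R ^+ m * expR (- (m%:R * eps ^+ 2 / (16 * b%:R))).
  apply: le_trans (H _) _; first by lra.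
  rewrite card_ord le_eqVlt; apply/orP; left; apply/eqP; congr (_ * expR (- _)).
  by field; rewrite gt_eqF.
apply: le_trans (lerD H IHs); rewrite -natrD ler_nat -cardUI.
apply: leq_trans (leq_addr _ _); apply: subset_leq_card.
by apply/fintype.subsetP => nu; rewrite !inE.
Qed.

End RIPOnNet.

(** * Choice of the constants and conclusion by counting bad samples *)

Theorem theorem4p3 (R : realType) :
  exists K : R, 0 < K /\
  forall (d r k s m : nat) (C eps delta : R),
  (2 <= d)%N -> (1 <= r)%N -> (1 <= k)%N -> (s <= d)%N ->
  0 < C -> 0 < eps < 1 -> 0 < delta < 1 ->
  m%:R >= 16 * k%:R * 2 ^+ s / eps ^+ 2 *
    (ln (2 / delta) +
     2 * d%:R * r%:R ^+ 2 *
       ln (16 * K * d%:R * Num.sqrt r%:R * k%:R * 2 ^+ s / eps)) ->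
  forall (disp : measure_display) (T : measurableType disp)
    (P : probability T R) (nu : 'I_m -> T -> 'I_(2 ^ d)),
  iid_uniform P nu ->
  ((1 - delta)%:E <=
   P [set w | forall X : tensor R d, model_class r s k C X ->
        (`| l2norm (measurement (fun l => nu l w) X) ^+ 2 - frob_norm X ^+ 2 |
        <= eps * frob_norm X ^+ 2)%R])%E.
Proof.
(* The constant is the factor [2 * expR 1] in the base of the code count. *)
exists (2 * expR 1); split; first by rewrite mulr_gt0// expR_gt0.
move=> d [//|r] k s m C eps delta d2 _ k0 _ C0 /andP[eps0 eps1] /andP[delta0 delta1].
pose b := (k * 2 ^ s)%N.
have bE : b%:R = k%:R * 2 ^+ s :> R by rewrite natrM natrX.
have b0 : (0 < b)%N by rewrite muln_gt0 k0 expn_gt0.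
have b0' : 0 < b%:R :> R by rewrite ltr0n.
have d0 : (0 < d)%N by apply: leq_trans d2.
pose n := (2 * d * r.+1 ^ 2)%N.
set A := 16 * _ * _ * _ * _ * _ / eps.
have nE : 2 * d%:R * r.+1%:R ^+ 2 = n%:R :> R by rewrite /n 2!natrM natrX.
rewrite nE; set L := ln (2 / delta) + _ => m_ge disp T P nu iid.
have {}m_ge : L <= m%:R * eps ^+ 2 / (16 * b%:R).
  rewrite ler_pdivlMr ?mulr_gt0// bE.
  have -> : L * (16 * (k%:R * 2 ^+ s)) = 16 * k%:R * 2 ^+ s / eps ^+ 2 * L * eps ^+ 2.
    by field; rewrite gt_eqF.
  by rewrite ler_pM2r// exprn_gt0.
pose M : R := d%:R * Num.sqrt r.+1%:R / (eps / (8 * b%:R)).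
(* This gives [M + 1 <= 2 * M], so the base of the net size is at most [A], the argument of the
   logarithm. *)
have M1 : 1 <= M.
  rewrite ler_pdivlMr ?divr_gt0 ?mulr_gt0// mul1r.
  apply: (@le_trans _ _ 1).
    rewrite ler_pdivrMr ?mulr_gt0// mul1r (le_trans (ltW eps1))//.
    have : 1 <= b%:R :> R by rewrite ler1n.
    by lra.
  by rewrite mulr_ege1 ?ler1n// -[leLHS]sqrtr1 ler_wsqrtr// ler1n.
have e0 : 0 < 2 * expR 1 :> R by rewrite mulr_gt0// expR_gt0.
have M0 : 0 <= M by apply: le_trans M1.
have AE : A = 2 * expR 1 * (2 * M).
  rewrite /A /M bE; field.
  by rewrite !gt_eqF ?exprn_gt0 ?ltr0n.
have eta0 : 0 < eps / (8 * b%:R) by rewrite divr_gt0// mulr_gt0.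
have [net [netU net_size netP]] := @tt_net R d r _ (sparse_tt r b) d0 eta0
  (fun X UX => let: And3 X1 rX _ := UX in conj X1 rX).
have {}net_size : (size net)%:R <= A ^+ n.
  apply: le_trans net_size _; rewrite -/n -/M AE; apply: lerXn2r.
  - exact: mulr_ge0 (ltW e0) (addr_ge0 M0 ler01).
  - exact: mulr_ge0 (ltW e0) (mulr_ge0 (ler0n _ 2) M0).
  - by rewrite ler_pM2l//; lra.
have A1 : 1 <= A.
  rewrite AE mulr_ege1//; last by lra.
  by have := expR_ge1Dx (1 : R); lra.
(* For [m = 0] the hypothesis would read [L <= 0], but [ln (2 / delta) > 0] and [ln A >= 0]. *)
have m0 : (0 < m)%N.
  rewrite lt0n; apply: contraTneq m_ge => ->; rewrite !mul0r -ltNge.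
  rewrite ltr_wpDr ?mulr_ge0 ?ln_ge0//.
  by rewrite ln_gt0// ltr_pdivlMr//; lra.
pose E (g : {ffun 'I_m -> 'I_(2 ^ d)}) := `[< forall X : tensor R d,
  model_class r.+1 s k C X ->
  `|l2norm (measurement (fun l => g l) X) ^+ 2 - frob_norm X ^+ 2| <=
    eps * frob_norm X ^+ 2 >].
set event := [set w | _].
have -> : event = [set w | E [ffun l => nu l w]].
  have nuE w : (fun l => [ffun l => nu l w] l) = (fun l => nu l w).
    by apply/funext => l; rewrite ffunE.
  apply/seteqP; split => w /= => [Hw|/asboolP Hw X /Hw]; last by rewrite nuE.
  by apply/asboolP => X /Hw; rewrite nuE.
rewrite (iid_uniform_prob E iid) lee_fin.
have N0 : 0 < (2 ^ d)%:R ^+ m :> R by rewrite exprn_gt0// ltr0n expn_gt0.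
rewrite ler_pdivlMr//.
set bad := [pred nu : {ffun 'I_m -> 'I_(2 ^ d)} |
     has (fun X => m%:R * (eps / 2) < `|\sum_l energy X (nu l) - m%:R|) net].
(* By the definition of [L], [expR (- L)] is [delta / 2] divided by [A ^+ n], which cancels the net
   size and the factor 2 of the two tails. *)
have bad_le : #|bad|%:R <= delta * (2 ^ d)%:R ^+ m.
  have eps01 : 0 <= eps <= 1 by rewrite !ltW.
  apply: le_trans (card_bad_samples m b0 eps01 netU) _.
  apply: le_trans (_ : A ^+ n * (2 * (2 ^ d)%:R ^+ m * expR (- L)) <= _).
    apply: ler_pM; rewrite ?mulr_ge0 ?expR_ge0 ?ler0n ?exprn_ge0//.
    by rewrite ler_wpM2l ?mulr_ge0 ?exprn_ge0// ler_expR lerN2.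
  have A0 : 0 < A by apply: lt_le_trans A1.
  rewrite /L opprD expRD -!lnV ?posrE ?divr_gt0// lnK ?posrE ?invr_gt0 ?divr_gt0//.
  rewrite expRN expRM_natl lnK//.
  rewrite le_eqVlt; apply/orP; left; apply/eqP.
  by field; rewrite !gt_eqF// exprn_gt0.
have : (2 ^ d)%:R ^+ m <= #|bad|%:R + #|E|%:R :> R.
  rewrite -natrD -natrX ler_nat -{1}(card_ord (2 ^ d)) -{1}(card_ord m) -card_ffun.
  rewrite -cardUI; apply: leq_trans (leq_addr _ _); apply: subset_leq_card.
  apply/fintype.subsetP => g _; rewrite !inE; apply/orP.
  have [gbad|/hasPn ggood] := boolP (has _ net); [by left|right].
  apply/asboolP => X [rX /low_order_supp_size bX _].
  apply: (rip_of_net m0 b0 eps0 netU netP _ rX bX) => Y netY.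
  by rewrite leNgt; exact: ggood.
by move: bad_le; lra.
Qed.
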